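(* Fix an integer $n \geqslant 2$ and let $[n] = \{1,\dots,n\}$. For metrics $\rho,\rho'$ on $[n]$ define $$d_{[n]}(\rho,\rho') = \log \max_{j \neq k} \frac{\rho'(j,k)}{\rho(j,k)} - \log \min_{j \neq k} \frac{\rho'(j,k)}{\rho(j,k)}.$$ (1) The map $d_{[n]}$ is a pseudometric on the space of metrics on $[n]$, and its equivalence classes (with $\rho,\rho'$ equivalent when $d_{[n]}(\rho,\rho')=0$) are precisely the classes of proportional metrics. (2) The quotient metric space $\mathcal{S}([n])$ is (up to isometry) a complete, path-connected metric subspace of the Banach space $\mathbb{R}^{\binom{[n]}{2}}/\sim \ = C(\binom{[n]}{2},\mathbb{R})/\sim$ with the diameter norm. (3) The space $\mathcal{S}([n])$ is a singleton if $n=2$, and unbounded otherwise.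
   Context: $\binom{[n]}{2}$ denotes the discrete set of two-element subsets of $[n]$. On the space $\mathbb{R}^{\binom{[n]}{2}}$ of real functions on $\binom{[n]}{2}$, $f \sim g$ means that $f-g$ is a constant function; the diameter norm on the quotient by $\sim$ is $\|[f]\| = \operatorname{diam}(\operatorname{im} f) = \max f - \min f$. The metric space $\mathcal{S}([n])$ is the quotient of the set of all metrics on $[n]$ by the relation $d_{[n]}(\rho,\rho')=0$, with the metric induced by $d_{[n]}$. Two metrics are proportional if one is a positive real multiple of the other. *)

(* Defs.v *)
From HB Require Import structures.
From mathcomp Require Import all_boot all_order all_algebra.
From mathcomp Require Import generic_quotient ring_quotient.
From mathcomp Require Import all_classical all_reals all_analysis.
From mathcomp Require Import ring lra.

Set Implicit Arguments.
Unset Strict Implicit.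
Unset Printing Implicit Defensive.

Import Order.TTheory GRing.Theory Num.Theory.
Import numFieldNormedType.Exports.

Local Open Scope classical_set_scope.
Local Open Scope ring_scope.
Local Open Scope quotient_scope.

(* Maximum and minimum of f over the (finitely many) points satisfying P;
   both are 0 when there is no such point. *)
Definition finmax (R : realType) (T : finType) (P : pred T) (f : T -> R) : R :=
  if [pick x | P x] is Some x0 then f [arg max_(x > x0 | P x) f x]%O else 0.

Definition finmin (R : realType) (T : finType) (P : pred T) (f : T -> R) : R :=
  if [pick x | P x] is Some x0 then f [arg min_(x < x0 | P x) f x]%O else 0.

Definition finosc (R : realType) (T : finType) (P : pred T) (f : T -> R) : R :=
  finmax P f - finmin P f.

Section FinMax.
Context {R : realType} {T : finType}.
Implicit Types (P : pred T) (f g : T -> R).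

Lemma finmaxP P f x : P x ->
  (exists2 y, P y & finmax P f = f y) /\ (forall z, P z -> f z <= finmax P f).
Proof.
move=> Px; rewrite /finmax; case: pickP => [x0 Px0|/(_ x)]; last by rewrite Px.
by case: arg_maxP => // y Py ymax; split=> [|z /ymax//]; exists y.
Qed.

Lemma finminP P f x : P x ->
  (exists2 y, P y & finmin P f = f y) /\ (forall z, P z -> finmin P f <= f z).
Proof.
move=> Px; rewrite /finmin; case: pickP => [x0 Px0|/(_ x)]; last by rewrite Px.
by case: arg_minP => // y Py ymin; split=> [|z /ymin//]; exists y.
Qed.

Lemma finosc_ge P f x y : P x -> P y -> f x - f y <= finosc P f.
Proof.
move=> Px Py; apply: lerB.
  by have [_] := finmaxP f Px; apply.
by have [_] := finminP f Px; apply.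
Qed.

Lemma finosc_le P f c : 0 <= c ->
  (forall x y, P x -> P y -> f x - f y <= c) -> finosc P f <= c.
Proof.
move=> c0 fc; have [[x Px]|P0] := pselect (exists x, P x).
  have [[y Py yE] _] := finmaxP f Px; have [[z Pz zE] _] := finminP f Px.
  by rewrite /finosc yE zE fc.
rewrite /finosc /finmax /finmin; case: pickP => [x Px|_]; last by rewrite subrr.
by exfalso; apply: P0; exists x.
Qed.

Lemma finosc_ge0 P f : 0 <= finosc P f.
Proof.
have [[x Px]|P0] := pselect (exists x, P x).
  by rewrite -(subrr (f x)) finosc_ge.
rewrite /finosc /finmax /finmin; case: pickP => [x Px|_]; last by rewrite subrr.
by exfalso; apply: P0; exists x.
Qed.

Lemma finosc_abs P f x y : P x -> P y -> `|f x - f y| <= finosc P f.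
Proof.
move=> Px Py; rewrite ler_norml finosc_ge// andbT lerNl opprB.
exact: finosc_ge.
Qed.

Lemma eq_finosc P f g :
  (forall x y, P x -> P y -> f x - f y = g x - g y) -> finosc P f = finosc P g.
Proof.
move=> fg; apply/eqP; rewrite eq_le; apply/andP; split; apply: finosc_le;
  rewrite ?finosc_ge0// => x y Px Py; [rewrite fg//|rewrite -fg//];
  exact: finosc_ge.
Qed.

Lemma finoscD P f g :
  finosc P (fun x => f x + g x) <= finosc P f + finosc P g.
Proof.
apply: finosc_le => [|x y Px Py]; first by rewrite addr_ge0// finosc_ge0.
by rewrite opprD addrACA lerD// finosc_ge.
Qed.

Lemma finoscZ P a f : finosc P (fun x => a * f x) = `|a| * finosc P f.
Proof.
have H b g : finosc P (fun x => b * g x) <= `|b| * finosc P g.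
  apply: finosc_le => [|x y Px Py]; first by rewrite mulr_ge0// finosc_ge0.
  rewrite -mulrBr (le_trans (ler_norm _))// normrM ler_wpM2l//.
  exact: finosc_abs.
apply/eqP; rewrite eq_le H /=; have [->|a0] := eqVneq a 0.
  by rewrite normr0 mul0r finosc_ge0.
rewrite -ler_pdivlMl ?normr_gt0// -normfV.
apply: le_trans (H _ _); rewrite le_eqVlt; apply/orP; left; apply/eqP.
by apply: eq_finosc => x y _ _; rewrite !mulKf.
Qed.

Lemma finosc0P P f :
  finosc P f = 0 <-> (forall x y, P x -> P y -> f x = f y).
Proof.
split=> [f0 x y Px Py|fc].
  have := finosc_abs f Px Py.
  by rewrite f0 normr_le0 subr_eq0 => /eqP.
apply/eqP; rewrite eq_le finosc_ge0 andbT; apply: finosc_le => // x y Px Py.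
by rewrite (fc x y)// subrr.
Qed.

Lemma ln_finosc P f : (forall x, P x -> 0 < f x) ->
  ln (finmax P f) - ln (finmin P f) = finosc P (fun x => ln (f x)).
Proof.
move=> f0; have [[x Px]|P0] := pselect (exists x, P x); last first.
  rewrite /finosc /finmax /finmin; case: pickP => [x Px|_]; last by rewrite !subrr.
  by exfalso; apply: P0; exists x.
have [[y Py ymax] lemax] := finmaxP f Px.
have [[z Pz zmin] lemin] := finminP f Px.
apply/eqP; rewrite eq_le; apply/andP; split.
  by rewrite ymax zmin (@finosc_ge P (fun x => ln (f x))).
apply: finosc_le => [|a b Pa Pb].
  by rewrite subr_ge0 ymax zmin ler_ln ?posrE ?f0// -ymax lemax.
by apply: lerB; rewrite ?ymax ?zmin ler_ln ?posrE ?f0// -?ymax -?zmin;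
  [exact: lemax|exact: lemin].
Qed.

End FinMax.

Record metric_on (R : realType) (n : nat) := MetricOn {
  metric_dist :> 'I_n -> 'I_n -> R ;
  metric_dist_ge0 : forall j k, 0 <= metric_dist j k ;
  metric_dist_eq0 : forall j k, metric_dist j k = 0 <-> j = k ;
  metric_distC : forall j k, metric_dist j k = metric_dist k j ;
  metric_distD : forall j k l,
    metric_dist j l <= metric_dist j k + metric_dist k l }.

HB.instance Definition _ (R : realType) (n : nat) :=
  gen_eqMixin (metric_on R n).
HB.instance Definition _ (R : realType) (n : nat) :=
  gen_choiceMixin (metric_on R n).

Definition offdiag (n : nat) : pred ('I_n * 'I_n) := fun p => p.1 != p.2.

Definition metric_ratio (R : realType) (n : nat) (rho rho' : metric_on R n)
    (p : 'I_n * 'I_n) : R :=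
  rho' p.1 p.2 / rho p.1 p.2.

Definition dlog (R : realType) (n : nat) (rho rho' : metric_on R n) : R :=
  ln (finmax (@offdiag n) (metric_ratio rho rho'))
  - ln (finmin (@offdiag n) (metric_ratio rho rho')).

Definition is_pseudometric (R : realType) (T : Type) (d : T -> T -> R) : Prop :=
  [/\ forall x y, 0 <= d x y,
      forall x, d x x = 0,
      forall x y, d x y = d y x
    & forall x y z, d x z <= d x y + d y z].

Definition proportional (R : realType) (n : nat) (rho rho' : metric_on R n) :
    Prop :=
  exists2 a : R, 0 < a & forall j k, rho' j k = a * rho j k.

Section DLog.
Context {R : realType} {n : nat}.
Implicit Types rho : metric_on R n.

Lemma metric_dist_gt0 rho j k : j != k -> 0 < rho j k.
Proof.
move=> jk; rewrite lt_neqAle metric_dist_ge0 andbT eq_sym.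
by apply/eqP => /metric_dist_eq0 /eqP; rewrite (negbTE jk).
Qed.

Lemma dlogE rho rho' :
  dlog rho rho' =
  finosc (@offdiag n) (fun p => ln (rho' p.1 p.2) - ln (rho p.1 p.2)).
Proof.
rewrite /dlog ln_finosc => [|p Pp]; last by rewrite divr_gt0// metric_dist_gt0.
apply: eq_finosc => p q Pp Pq.
by rewrite /metric_ratio !ln_div ?posrE ?metric_dist_gt0.
Qed.

Lemma dlog_pseudometric : is_pseudometric (@dlog R n).
Proof.
split=> [x y|x|x y|x y z]; rewrite !dlogE.
- exact: finosc_ge0.
- by apply/finosc0P => p q _ _; rewrite !subrr.
- rewrite -[LHS]mul1r -[X in X * _]normr1 -normrN -finoscZ.
  by apply: eq_finosc => p q _ _; rewrite !mulN1r !opprB.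
- apply: le_trans (finoscD _ _ _); rewrite le_eqVlt; apply/orP; left; apply/eqP.
  apply: eq_finosc => p q _ _.
  by rewrite !(addrC (ln (y _ _) - _)) !addrA !subrK.
Qed.

Definition dlog_eq rho rho' : bool := dlog rho rho' == 0.

Lemma dlog_eq_equiv : equiv_class_of dlog_eq.
Proof.
have [d0 dxx dC dD] := dlog_pseudometric.
split=> [x|x y|y x z]; rewrite /dlog_eq; first by rewrite dxx.
  by rewrite dC.
by move=> /eqP xy /eqP yz; rewrite eq_le d0 andbT (le_trans (dD x y z))// xy yz addr0.
Qed.

Canonical dlog_eq_equivRel := EquivRelPack dlog_eq_equiv.

End DLog.

Definition dlog_space (R : realType) (n : nat) : Type :=
  {eq_quot (@dlog_eq R n)}.

HB.instance Definition _ (R : realType) (n : nat) :=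
  Choice.on (dlog_space R n).
HB.instance Definition _ (R : realType) (n : nat) :
  EqQuotient (metric_on R n) (@dlog_eq R n) (dlog_space R n) :=
  EqQuotient.on (dlog_space R n).

Section DlogSpace.
Context {R : realType} {n : nat}.
Local Notation S := (dlog_space R n).

Let dS (x y : S) : R := dlog (repr x) (repr y).

Let dS_pi rho rho' : dS (\pi_S rho) (\pi_S rho') = dlog rho rho'.
Proof.
have [d0 dxx dC dD] := @dlog_pseudometric R n.
have r0 x : dlog (repr (\pi_S x)) x = 0.
  have /eqP : repr (\pi_S x) = x %[mod S] by rewrite reprK.
  by rewrite piE /= /dlog_eq => /eqP.
apply/eqP; rewrite eq_le; apply/andP; split.
  rewrite (le_trans (dD _ rho _))// r0 add0r (le_trans (dD _ rho' _))//.
  by rewrite [X in _ + X]dC r0 addr0.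
rewrite (le_trans (dD _ (repr (\pi_S rho)) _))// dC r0 add0r.
by rewrite (le_trans (dD _ (repr (\pi_S rho')) _))// r0 addr0.
Qed.

Let dSxx x : dS x x = 0.
Proof. by have [_ dxx _ _] := @dlog_pseudometric R n; exact: dxx. Qed.

Let dS_eq0 x y : dS x y = 0 -> x = y.
Proof.
move=> /eqP xy; rewrite -[x]reprK -[y]reprK; apply/eqP.
by rewrite piE.
Qed.

Let dSC x y : dS x y = dS y x.
Proof. by have [_ _ dC _] := @dlog_pseudometric R n; exact: dC. Qed.

Let dSD y x z : dS x z <= dS x y + dS y z.
Proof. by have [_ _ _ dD] := @dlog_pseudometric R n; exact: dD. Qed.

HB.instance Definition _ := @isMetric.Build R S dS dSxx dS_eq0 dSC dSD.

Lemma mdist_pi rho rho' :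
  mdist (\pi_S rho) (\pi_S rho') = dlog rho rho'.
Proof. exact: dS_pi. Qed.

End DlogSpace.

Definition is_constant (R : realType) (E : finType) : {pred {ffun E -> R}} :=
  fun f => `[< exists c : R, forall e, f e = c >].

Section IsConstant.
Context {R : realType} {E : finType}.

Lemma is_constantP (f : {ffun E -> R}) :
  reflect (exists c : R, forall e, f e = c) (f \in @is_constant R E).
Proof. exact: asboolP. Qed.

Lemma is_constant_zmod : zmod_closed (@is_constant R E).
Proof.
split=> [|f g /is_constantP[a fa] /is_constantP[b gb]].
  by apply/is_constantP; exists 0 => e; rewrite ffunE.
by apply/is_constantP; exists (a - b) => e; rewrite !ffunE fa gb.
Qed.

HB.instance Definition _ :=
  GRing.isZmodClosed.Build {ffun E -> R} (@is_constant R E) is_constant_zmod.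

End IsConstant.

(* The quotient of R^E by f ~ g iff f - g is constant (fun_mod_constP). *)
Definition fun_mod_const (R : realType) (E : finType) : Type :=
  Quotient.quot (@is_constant R E : zmodClosed {ffun E -> R}).

HB.instance Definition _ (R : realType) (E : finType) :=
  GRing.Zmodule.on (fun_mod_const R E).
HB.instance Definition _ (R : realType) (E : finType) :=
  ZmodQuotient.on (fun_mod_const R E).

Section FunModConst.
Context {R : realType} {E : finType}.
Local Notation Q := (fun_mod_const R E).
Implicit Types (f g : {ffun E -> R}) (x y : Q).

Lemma fun_mod_constP f g :
  reflect (exists c : R, forall e, f e - g e = c) (f == g %[mod Q]).
Proof.
rewrite -Quotient.idealrBE; apply: (iffP (is_constantP _)) => -[c fg];
  by exists c => e; rewrite -(fg e) !ffunE.
Qed.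

Definition fun_mod_scale (a : R) x : Q := \pi_Q (a *: repr x).

Let piP x : exists f, x = \pi_Q f.
Proof. by exists (repr x); rewrite reprK. Qed.

Lemma pi_fun_mod0 : \pi_Q 0 = 0.
Proof. exact: pi_zeror. Qed.

Lemma pi_fun_modD f g : \pi_Q (f + g) = \pi_Q f + \pi_Q g.
Proof. exact: pi_addr. Qed.

Lemma pi_fun_modB f g : \pi_Q (f - g) = \pi_Q f - \pi_Q g.
Proof. by rewrite pi_fun_modD; congr (_ + _); exact: pi_oppr. Qed.

Let repr_pi f : exists c : R, forall e, repr (\pi_Q f) e - f e = c.
Proof. by apply/fun_mod_constP; rewrite reprK. Qed.

Let scaleQ_pi a f : fun_mod_scale a (\pi_Q f) = \pi_Q (a *: f).
Proof.
apply/eqP/fun_mod_constP; have [c fc] := repr_pi f.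
by exists (a * c) => e; rewrite !ffunE -scalerBr fc.
Qed.

Let scaleQA a b x : fun_mod_scale a (fun_mod_scale b x) = fun_mod_scale (a * b) x.
Proof. by have [f ->] := piP x; rewrite !scaleQ_pi scalerA. Qed.

Let scale1Q x : fun_mod_scale 1 x = x.
Proof. by have [f ->] := piP x; rewrite scaleQ_pi scale1r. Qed.

Let scaleQDr a x y : fun_mod_scale a (x + y) = fun_mod_scale a x + fun_mod_scale a y.
Proof.
have [f ->] := piP x; have [g ->] := piP y.
by rewrite -pi_fun_modD !scaleQ_pi scalerDr pi_fun_modD.
Qed.

Let scaleQDl x a b : fun_mod_scale (a + b) x = fun_mod_scale a x + fun_mod_scale b x.
Proof. by have [f ->] := piP x; rewrite !scaleQ_pi scalerDl pi_fun_modD. Qed.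

HB.instance Definition _ :=
  GRing.Zmodule_isLmodule.Build R Q scaleQA scale1Q
    (fun a x y => scaleQDr a x y) scaleQDl.

Lemma pi_fun_modZ a f : \pi_Q (a *: f) = a *: \pi_Q f.
Proof. by rewrite -scaleQ_pi. Qed.

Definition diam_norm x : R := finosc predT (repr x).

Let normQ_pi f : diam_norm (\pi_Q f) = finosc predT f.
Proof.
have [c fc] := repr_pi f.
have fE e : repr (\pi_Q f) e = f e + c by rewrite -(fc e) addrC subrK.
by apply: eq_finosc => a b _ _; rewrite !fE opprD addrACA subrr addr0.
Qed.

Let normQD x y : diam_norm (x + y) <= diam_norm x + diam_norm y.
Proof.
have [f ->] := piP x; have [g ->] := piP y; rewrite -pi_fun_modD !normQ_pi.
apply: le_trans (finoscD _ _ _); rewrite le_eqVlt; apply/orP; left; apply/eqP.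
by apply: eq_finosc => a b _ _; rewrite !ffunE.
Qed.

Let normQZ (a : R) x : diam_norm (a *: x) = `|a| * diam_norm x.
Proof.
have [f ->] := piP x; rewrite -pi_fun_modZ !normQ_pi -finoscZ.
by apply: eq_finosc => b c _ _; rewrite !ffunE.
Qed.

Let normQ_eq0 x : diam_norm x = 0 -> x = 0.
Proof.
have [f ->] := piP x; rewrite normQ_pi -pi_fun_mod0 => /finosc0P fc.
apply/eqP/fun_mod_constP; case: (pickP (@predT E)) => [e0 _|E0].
  by exists (f e0) => e; rewrite ffunE subr0 (fc e e0).
by exists 0 => e; have := E0 e.
Qed.

HB.instance Definition _ := Lmodule_isNormed.Build R Q normQD normQZ normQ_eq0.

Lemma norm_pi f : `|\pi_Q f| = finmax predT f - finmin predT f.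
Proof. exact: normQ_pi. Qed.

Let norm_subE x y :
  `|x - y| = finosc predT (fun e => repr x e - repr y e).
Proof.
have -> : x - y = \pi_Q (repr x - repr y) by rewrite pi_fun_modB !reprK.
by rewrite norm_pi; apply: eq_finosc => a b _ _; rewrite !ffunE.
Qed.

Let Q_complete (F : set_system Q) : ProperFilter F -> cauchy F -> cvg F.
Proof.
move=> FF /cauchy_ballP Fc.
pose ev (e : E) x : R :=
  repr x e - (if [pick e : E] is Some e0 then repr x e0 else 0).
have evB e x y : `|ev e x - ev e y| <= `|x - y|.
  rewrite /ev norm_subE; case: pickP => [e0 _|/(_ e)//].
  have -> : repr x e - repr x e0 - (repr y e - repr y e0) =
    (repr x e - repr y e) - (repr x e0 - repr y e0) by ring.
  exact: (@finosc_abs _ _ predT (fun e => repr x e - repr y e)).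
have evc e : cvg (ev e @ F).
  apply: R_complete; apply/cauchy_ballP => eps eps0.
  have [[A B] [FA FB] AB] := Fc _ eps0.
  exists (ev e @` A, ev e @` B) => /=.
    by split; rewrite /nbhs/=; [apply: filterS FA|apply: filterS FB] => x ?;
      exists x.
  move=> [_ _] /= [[x Ax <-] [y By <-]].
  have := AB (x, y) (conj Ax By).
  by rewrite -!ball_normE /= => /(le_lt_trans (evB e x y)).
pose l := [ffun e => lim (ev e @ F)].
have l_cvg e : ev e @ F --> l e by rewrite ffunE; exact: evc.
apply/cvg_ex; exists (\pi_Q l); apply/cvgrPdist_lt => eps eps0.
have eps4 : 0 < eps / 4 by rewrite divr_gt0.
have : \forall x \near F, forall e, `|l e - ev e x| < eps / 4.
  apply: filter_forall => e.
  by have /cvgrPdist_lt := l_cvg e; apply.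
apply: filterS => x lx.
have -> : \pi_Q l - x = \pi_Q (l - repr x) by rewrite pi_fun_modB reprK.
rewrite norm_pi; suff : finosc predT (l - repr x) <= eps / 2.
  by move=> /le_lt_trans; apply; rewrite ltr_pdivrMr// ltr_pMr// ltr1n.
apply: finosc_le => [|a b _ _]; first by rewrite divr_ge0// ltW.
have -> : (l - repr x) a - (l - repr x) b = (l a - ev a x) - (l b - ev b x).
  by rewrite /ev !ffunE; ring.
rewrite (le_trans (ler_norm _))// (le_trans (ler_normB _ _))//.
have -> : eps / 2 = eps / 4 + eps / 4 by field.
by rewrite lerD// ltW.
Qed.

HB.instance Definition _ := Uniform_isComplete.Build Q Q_complete.

End FunModConst.

Definition edge (n : nat) : finType := {A : {set 'I_n} | #|A| == 2%N}.

Definition complete_space (T : uniformType) : Prop :=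
  forall F : set_system T, ProperFilter F -> cauchy F -> exists l : T, F --> l.

Definition path_connected (R : realType) (T : topologicalType) : Prop :=
  forall x y : T, exists gamma : R -> T,
    [/\ {within `[0, 1], continuous gamma}, gamma 0 = x & gamma 1 = y].

(* Main.v *)
Require Import Defs.
From mathcomp Require Import all_boot all_order all_algebra.
From mathcomp Require Import generic_quotient.
From mathcomp Require Import all_classical all_reals all_analysis.
From mathcomp Require Import ring lra.

Import Order.TTheory GRing.Theory Num.Theory.
Import numFieldNormedType.Exports.

Local Open Scope classical_set_scope.
Local Open Scope ring_scope.
Local Open Scope quotient_scope.

(** Everything follows from one formula, [dlogE]: the distance between two
    metrics is the oscillation, over pairs j != k, of the difference of their
    logarithms. So rho |-> log rho turns d into the diameter seminorm, which
    makes d a pseudometric; its zero set consists of the pairs whose logarithms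
    differ by a constant, that is, of proportional metrics
    ([dlog_eq0_proportional]); and sending the class of rho to the class of
    log rho, read on two-element subsets, is an isometric embedding
    ([dlog_embedding]).

    Convergence in the quotient can be tested on representatives, after
    rescaling each of them by any positive factor: pointwise convergence to a
    metric suffices ([cvg_dlog_space]), because there are finitely many pairs
    and the logarithm is continuous at positive reals. For completeness
    ([dlog_space_complete]), rescale every metric so that one fixed pair has
    distance 1. The logarithms of the rescaled distances are 1-Lipschitz for d,
    so they converge along a Cauchy filter to finite limits; exponentiating, the
    limit of the distances is positive off the diagonal, and the triangle
    inequality passes to the limit. For path-connectedness
    ([dlog_space_path_connected]), metrics form a convex cone, so a segment of
    metrics joins any two.

    If n = 2 there is a single pair, so all metrics are proportional. If n > 2,
    the distance between two points can be made arbitrarily small while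
    all others stay equal to 1, which moves the metric arbitrarily far away
    ([dlog_space_unbounded]). *)

(** * Oscillation and the construction of metrics *)

Lemma finosc_reindex {R : realType} {T U : finType} (P : pred T) (Q : pred U)
    (f : T -> R) (g : U -> R) :
  (forall x, P x -> exists2 y, Q y & f x = g y) -> finosc P f <= finosc Q g.
Proof.
move=> fg; apply: finosc_le => [|x y Px Py]; first exact: finosc_ge0.
have [x' Qx ->] := fg x Px; have [y' Qy ->] := fg y Py.
exact: finosc_ge.
Qed.

(** The diagonal is set to 0 by hand, and the degenerate triangles are automatic,
    so that a limit or a modification of metrics need only be examined on
    distinct points. *)
Lemma offdiag_metric {R : realType} {n : nat} (w : 'I_n -> 'I_n -> R) :
  (forall j k, j != k -> 0 < w j k) ->
  (forall j k, w j k = w k j) ->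
  (forall j k l, j != k -> k != l -> j != l -> w j l <= w j k + w k l) ->
  exists rho : metric_on R n, forall j k, j != k -> rho j k = w j k.
Proof.
move=> w0 wC wD; pose d j k := if j == k then 0 else w j k.
have d0 j k : 0 <= d j k.
  by rewrite /d; case: eqVneq => // /w0 /ltW.
have dE j k : d j k = 0 <-> j = k.
  split=> [|->]; last by rewrite /d eqxx.
  by rewrite /d; case: eqVneq => // /w0 /[swap] ->; rewrite ltxx.
have dC j k : d j k = d k j by rewrite /d eq_sym wC.
have dD j k l : d j l <= d j k + d k l.
  have [->|jk] := eqVneq j k; first by rewrite lerDr d0.
  have [->|kl] := eqVneq k l; first by rewrite lerDl d0.
  have [->|jl] := eqVneq j l; first by rewrite {1}/d eqxx addr_ge0.
  by rewrite /d (negbTE jk) (negbTE kl) (negbTE jl) wD.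
exists (MetricOn d0 dE dC dD) => j k jk.
by rewrite /= /d (negbTE jk).
Qed.

(** The space equals 1 away from one pair of points, whose distance [a] is free:
    a triangle then has sides a, 1, 1 or 1, 1, 1. *)
Lemma two_valued_metric {R : realType} {n : nat} (i0 i1 : 'I_n) (a : R) :
  0 < a <= 1 ->
  exists rho : metric_on R n, forall j k, j != k ->
    rho j k = if [set j; k]%SET == [set i0; i1]%SET then a else 1.
Proof.
move=> /andP[a0 a1]; apply: offdiag_metric => [j k _|j k|j k l jk kl jl].
- by case: ifP.
- by rewrite finset.setUC.
case: (eqVneq [set j; k]%SET _) => [jkE|_]; last first.
  by case: ifP => _; case: ifP => _; lra.
case: (eqVneq [set k; l]%SET _) => [klE|_]; last by case: ifP => _; lra.
(* two sides of a nondegenerate triangle are different pairs *)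
have : j \in [set k; l]%SET by rewrite klE -jkE !inE eqxx.
by rewrite !inE (negbTE jk) (negbTE jl).
Qed.

(** * The equivalence relation and the embedding *)

Section Dlog.
Context {R : realType} {n : nat}.
Implicit Types rho : metric_on R n.
Local Notation S := (dlog_space R n).
Local Notation Q := (fun_mod_const R (edge n)).

Lemma mdist_finosc_ln (s t : S) :
  mdist s t = finosc (@offdiag n)
    (fun p => ln (repr s p.1 p.2) - ln (repr t p.1 p.2)).
Proof.
have [_ _ dC _] := @dlog_pseudometric R n.
by rewrite -dlogE dC -mdist_pi !reprK.
Qed.

Lemma dlog_eq0_proportional (hn : (2 <= n)%N) rho rho' :
  dlog rho rho' = 0 <-> proportional rho rho'.
Proof.
case: n hn rho rho' => [|[|m]]// _ rho rho'.
rewrite dlogE; split=> [/finosc0P H|[a a0 aE]]; last first.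
  apply/finosc0P => p q Pp Pq.
  by rewrite !aE !lnM ?posrE ?metric_dist_gt0// !addrK.
have r0 : 0 < rho ord0 ord_max by exact: metric_dist_gt0.
have r0' : 0 < rho' ord0 ord_max by exact: metric_dist_gt0.
exists (rho' ord0 ord_max / rho ord0 ord_max); first exact: divr_gt0.
move=> j k; have [->|jk] := eqVneq j k.
  rewrite (iffRL (metric_dist_eq0 rho' k k)) ?(iffRL (metric_dist_eq0 rho k k))//.
  by rewrite mulr0.
have rjk := metric_dist_gt0 rho jk; have rjk' := metric_dist_gt0 rho' jk.
have := H (j, k) (ord0, ord_max) jk isT.
rewrite /= -!ln_div ?posrE// => /ln_inj; rewrite !posrE !divr_gt0//.
by move=> /(_ isT isT) <-; rewrite divfK// gt_eqF.
Qed.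

(** The two-element subset is not ordered, so evaluating log rho on it goes
    through a choice of endpoints; symmetry of rho makes the choice immaterial. *)
Lemma dlog_embedding :
  exists iota : S -> (Q : completeNormedModType R),
    forall s t, `|iota s - iota t| = mdist s t.
Proof.
have endsP (e : edge n) :
    exists p : 'I_n * 'I_n, offdiag p /\ val e = [set p.1; p.2]%SET.
  by have /cards2P[x [y [xy eE]]] := valP e; exists (x, y).
have {endsP} [ends endsP] := choice endsP.
exists (fun s : S => \pi_Q [ffun e => ln (repr s (ends e).1 (ends e).2)]) => s t.
rewrite -pi_fun_modB norm_pi mdist_finosc_ln.
apply/eqP; rewrite eq_le; apply/andP; split; apply: finosc_reindex.
  move=> e _; have [pe _] := endsP e; exists (ends e) => //.
  by rewrite !ffunE.
move=> [j k] jk /=.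
have jk2 : #|[set j; k]%SET| == 2 by rewrite cards2 (jk : j != k).
pose e : edge n := exist _ [set j; k]%SET jk2.
exists e => //; rewrite !ffunE; have [] := endsP e.
case: (ends e) => x y /= xy jkE.
have : x \in [set j; k]%SET by rewrite jkE !inE eqxx.
have : y \in [set j; k]%SET by rewrite jkE !inE eqxx orbT.
move: xy; rewrite /offdiag !inE /= => xy /orP[] /eqP yE /orP[] /eqP xE;
  rewrite xE yE ?eqxx// in xy *.
by rewrite !(metric_distC _ k).
Qed.

(** * Convergence, completeness and paths *)

(** The rescaling factor [c] does not change the classes, and disappears from
    the oscillation as an additive constant [ln c]. *)
Lemma cvg_dlog_space {T : Type} {F : set_system T} {FF : Filter F}
    (g : T -> metric_on R n) (c : T -> R) rho :
  (forall x, 0 < c x) ->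
  (forall j k : 'I_n, j != k -> c x * g x j k @[x --> F] --> rho j k) ->
  \pi_S (g x) @[x --> F] --> \pi_S rho.
Proof.
move=> c0 gc; apply/metricType_numDomainType.cvgrPdist_lt => eps eps0.
have eps4 : 0 < eps / 4 by rewrite divr_gt0.
have : \forall x \near F, forall p : 'I_n * 'I_n, offdiag p ->
    `|ln (rho p.1 p.2) - ln (c x * g x p.1 p.2)| < eps / 4.
  apply: filter_forall => p.
  have [pp|np] := boolP (offdiag p); last exact: nearW.
  have /cvgrPdist_lt/(_ _ eps4) :
      ln (c x * g x p.1 p.2) @[x --> F] --> ln (rho p.1 p.2).
    apply: continuous_cvg; last exact: gc.
    exact: (continuous_ln (metric_dist_gt0 rho pp)).
  by apply: filterS => x + _.
apply: filterS => x gx; rewrite mdist_pi dlogE.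
apply: (@le_lt_trans _ _ (eps / 2)); last by lra.
apply: finosc_le => [|p q pp pq]; first by rewrite divr_ge0// ltW.
have := gx p pp; have := gx q pq.
rewrite !lnM ?posrE ?metric_dist_gt0// !ltr_norml => /andP[? ?] /andP[? ?].
by lra.
Qed.

Lemma dlog_space_complete (hn : (2 <= n)%N) : complete_space S.
Proof.
move=> F FF /cauchy_ballP Fc.
have [i0 [i1 i01]] : exists i0 i1 : 'I_n, i0 != i1.
  by exists (Ordinal (ltnW hn)), (Ordinal hn).
pose w (s : S) j k : R := (repr s i0 i1)^-1 * repr s j k.
have c0 (s : S) : 0 < (repr s i0 i1)^-1 by rewrite invr_gt0 metric_dist_gt0.
have w0 s (j k : 'I_n) : j != k -> 0 < w s j k.
  by move=> jk; rewrite mulr_gt0// metric_dist_gt0.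
have lipw (j k : 'I_n) s t : j != k -> `|ln (w s j k) - ln (w t j k)| <= mdist s t.
  move=> jk; rewrite mdist_finosc_ln.
  have := @finosc_abs _ _ (@offdiag n)
    (fun p => ln (repr s p.1 p.2) - ln (repr t p.1 p.2)) (j, k) (i0, i1) jk i01.
  apply: le_trans; rewrite /w !lnM ?posrE ?metric_dist_gt0//.
  rewrite !lnV ?posrE ?metric_dist_gt0// le_eqVlt; apply/orP; left; apply/eqP.
  by congr `| _ |; rewrite /=; ring.
have wlim (j k : 'I_n) : j != k ->
    exists2 l : R, 0 < l & w s j k @[s --> F] --> l.
  move=> jk; have : cvg (ln (w s j k) @[s --> F]).
    apply: R_complete; apply/cauchy_ballP => eps eps0.
    have [[A B] [FA FB] AB] := Fc _ eps0.
    exists ((fun s => ln (w s j k)) @` A, (fun s => ln (w s j k)) @` B) => /=.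
      by split; rewrite /nbhs/=; [apply: filterS FA|apply: filterS FB] => x ?;
        exists x.
    move=> [_ _] /= [[x Ax <-] [y By <-]].
    have := AB (x, y) (conj Ax By); rewrite ballEmdist -ball_normE /=.
    exact: (le_lt_trans (lipw j k x y jk)).
  move=> /cvg_ex[l wl]; exists (expR l); first exact: expR_gt0.
  have : expR (ln (w s j k)) @[s --> F] --> expR l.
    by apply: continuous_cvg => //; exact: continuous_expR.
  apply: cvg_trans; apply: near_eq_cvg; apply: nearW => s /=.
  by rewrite lnK// posrE w0.
pose l j k : R := lim (w s j k @[s --> F]).
have wl (j k : 'I_n) : j != k -> w s j k @[s --> F] --> l j k.
  by move=> /wlim[a _ wa]; apply: cvgP wa.
have [rho rhoE] : exists rho : metric_on R n, forall j k, j != k ->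
    rho j k = l j k.
  apply: offdiag_metric => [j k jk|j k|i j k ij jk ik].
  - by have [a a0 wa] := wlim j k jk; rewrite /l (cvg_lim _ wa).
  - rewrite /l; suff -> : (fun s => w s j k) = (fun s => w s k j) by [].
    by apply/funext => s; rewrite /w [X in _ * X]metric_distC.
  - apply: (ler_cvg_to (wl _ _ ik) (cvgD (wl _ _ ij) (wl _ _ jk))).
    by apply: nearW => s /=; rewrite -mulrDr ler_wpM2l ?metric_distD// ltW.
exists (\pi_S rho).
have := @cvg_dlog_space _ F _ (fun s : S => repr s) _ rho c0.
rewrite (_ : (fun s : S => \pi_S (repr s)) = id); last first.
  by apply/funext => s /=; rewrite reprK.
by apply=> j k jk; rewrite rhoE//; exact: wl.
Qed.

Lemma dlog_space_path_connected : path_connected R S.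
Proof.
move=> s t.
(* absolute values extend the segment to a path of metrics over the whole line *)
have gP (x : R) : exists rho : metric_on R n, forall j k, j != k ->
    rho j k = `|1 - x| * repr s j k + `|x| * repr t j k.
  apply: offdiag_metric => [j k jk|j k|i j k _ _ _].
  - have sjk := metric_dist_gt0 (repr s) jk.
    have tjk := metric_dist_gt0 (repr t) jk.
    have [->|x0] := eqVneq x 0; first by rewrite subr0 normr1 normr0; lra.
    by rewrite ltr_wpDl ?mulr_ge0 ?metric_dist_ge0// mulr_gt0 ?normr_gt0.
  - by rewrite metric_distC [X in _ + _ * X]metric_distC.
  - by rewrite addrACA -!mulrDr lerD// ler_wpM2l// metric_distD.
have {gP} [g gE] := choice gP.
have pi_eq rho (u : S) : (forall j k, j != k -> rho j k = repr u j k) ->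
    \pi_S rho = u.
  move=> ru; apply/eqP; rewrite -[u in X in _ == X]reprK piE /= /dlog_eq dlogE.
  by apply/eqP/finosc0P => p q pp pq; rewrite !ru// !subrr.
exists (fun x => \pi_S (g x)); split.
- apply: continuous_subspaceT => x.
  apply: (@cvg_dlog_space _ _ _ g (fun=> 1)) => // j k jk; rewrite gE//.
  rewrite (_ : (fun y => _) =
    (fun y => `|1 - y| * repr s j k + `|y| * repr t j k)); last first.
    by apply/funext => y; rewrite mul1r gE.
  apply: cvgD; (apply: cvgM; last exact: cvg_cst); apply: cvg_norm.
    by apply: cvgB; [exact: cvg_cst|exact: cvg_id].
  exact: cvg_id.
- by apply: pi_eq => j k jk; rewrite gE// subr0 normr1 normr0 mul1r mul0r addr0.
- by apply: pi_eq => j k jk; rewrite gE// subrr normr1 normr0 mul1r mul0r add0r.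
Qed.

(** * Size of the space *)

Lemma dlog_space_unbounded (hn : (2 < n)%N) (M : R) :
  exists s t : S, M < mdist s t.
Proof.
pose i0 : 'I_n := Ordinal (ltnW (ltnW hn)).
pose i1 : 'I_n := Ordinal (ltnW hn).
pose i2 : 'I_n := Ordinal hn.
pose a : R := expR (- (`|M| + 1)).
have a01 : 0 < a <= 1 by rewrite expR_gt0/= -expR0 ler_expR oppr_le0 addr_ge0.
have [rho rhoE] := @two_valued_metric R n i0 i1 a a01.
have [tau tauE] := @two_valued_metric R n i0 i1 1 ltac:(lra).
exists (\pi_S rho), (\pi_S tau); rewrite mdist_pi dlogE.
have := @finosc_ge _ _ (@offdiag n)
  (fun p => ln (tau p.1 p.2) - ln (rho p.1 p.2)) (i0, i1) (i0, i2) isT isT.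
have i02E : ([set i0; i2]%SET == [set i0; i1]%SET) = false.
  apply/negbTE/eqP => /setP /(_ i2).
  by rewrite !inE eqxx orbT.
rewrite /= !tauE// !rhoE// eqxx i02E ln1 expRK.
apply: lt_le_trans; rewrite subrr sub0r opprK subr0.
by rewrite (le_lt_trans (ler_norm M))// ltrDl.
Qed.

End Dlog.

Lemma dlog_space2_singleton {R : realType} :
  exists s : dlog_space R 2, forall t, t = s.
Proof.
have [rho _] := @two_valued_metric R 2 ord0 ord0 1 ltac:(lra).
exists (\pi_(dlog_space R 2) rho) => t.
apply/eqP; rewrite -[t]reprK piE /= /dlog_eq.
have ord2 (j : 'I_2) : j = ord0 \/ j = ord_max.
  by case: j => [[|[|//]] ?]; [left|right]; exact: val_inj.
have one_pair (r : metric_on R 2) p : offdiag p -> r p.1 p.2 = r ord0 ord_max.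
  case: p => j k; rewrite /offdiag /=.
  have [->|->] := ord2 j; have [->|->] := ord2 k => //= _.
  exact: metric_distC.
by apply/eqP; rewrite dlogE; apply/finosc0P => p q pp pq; rewrite !one_pair.
Qed.

Theorem theorem4p1 (R : realType) (n : nat) (hn : (2 <= n)%N) :
  [/\ is_pseudometric (@dlog R n) /\
      (forall rho : metric_on R n,
         [set rho' | dlog rho rho' = 0] = [set rho' | proportional rho rho']),
      [/\ complete_space (dlog_space R n),
          path_connected R (dlog_space R n)
        & exists iota : dlog_space R n ->
              (fun_mod_const R (edge n) : completeNormedModType R),
            forall s t, `|iota s - iota t| = mdist s t]
    & (n = 2%N -> exists s : dlog_space R n, forall t, t = s) /\
      (n <> 2%N -> forall M : R, exists s t : dlog_space R n, M < mdist s t)].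
Proof.
split.
- split; first exact: dlog_pseudometric.
  move=> rho; apply/seteqP; split=> rho' /=;
    by have [] := dlog_eq0_proportional hn rho rho'.
- split; [exact: dlog_space_complete|exact: dlog_space_path_connected|].
  exact: dlog_embedding.
- split=> [n2|/eqP n2]; first by move: hn; rewrite n2 => _; exact: dlog_space2_singleton.
  by apply: dlog_space_unbounded; rewrite ltn_neqAle eq_sym n2.
Qed.
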